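(* For every integer $n \geq 1$ and every integer $m \in \{0,1,\ldots,\binom{n}{2}\}$, there exists an optimally-greatest graph for the independence polynomial in $\mathcal{S}_{n,m}$; that is, there exists $H \in \mathcal{S}_{n,m}$ such that $I(H,x) \geq I(G,x)$ for all $G \in \mathcal{S}_{n,m}$ and all real $x \geq 0$.
   Context: All graphs are finite and simple. $\mathcal{S}_{n,m}$ denotes the set of simple graphs with $n$ vertices (order $n$) and $m$ edges (size $m$). The independence polynomial of a graph $G$ is $I(G,x) = \sum_{j} i_j x^j$, where $i_j$ is the number of independent sets of vertices of $G$ of cardinality $j$ (the empty set is counted, so $i_0 = 1$). *)

(* Defs.v *)
From HB Require Import structures.
From mathcomp Require Import all_boot all_order all_algebra.
From mathcomp Require Import reals.

Set Implicit Arguments.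
Unset Strict Implicit.
Unset Printing Implicit Defensive.

Import Order.TTheory GRing.Theory Num.Theory.

Local Open Scope ring_scope.

Record sgraph := SGraph {
  vertex :> finType;
  adj : rel vertex;
  adj_sym : symmetric adj;
  adj_irr : irreflexive adj
}.

Definition edges (G : sgraph) : {set {set G}} :=
  [set [set x; y] | x in [set: G], y in [set: G] & adj x y].

(* The class S_{n,m} of graphs of order n and size m, as a predicate on graphs with an arbitrary finite
   vertex type. *)
Definition graph_class (n m : nat) (G : sgraph) : Prop :=
  #|G| = n /\ #|edges G| = m.

Definition independent (G : sgraph) (A : {set G}) : bool :=
  [forall x in A, forall y in A, ~~ adj x y].

Definition indep_count (G : sgraph) (j : nat) : nat :=
  #|[set A : {set G} | independent A & #|A| == j]|.

(* No independent set has more than [#|G|] vertices, so the coefficients left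
   out are zero. *)
Definition indep_poly (R : nzSemiRingType) (G : sgraph) : {poly R} :=
  \poly_(j < #|G|.+1) (indep_count G j)%:R.

Definition optimally_greatest (R : realType) (n m : nat) (H : sgraph) : Prop :=
  graph_class n m H /\
  forall G : sgraph, graph_class n m G ->
  forall x : R, 0 <= x -> (indep_poly R G).[x] <= (indep_poly R H).[x].

(* Main.v *)
Require Import Defs.
From mathcomp Require Import all_boot all_order all_algebra.
From mathcomp Require Import reals zify.

(** For every [j] the independent sets of size [j] are the [j]-cliques of the
    complement, and the complement has [M = 'C(n, 2) - m] edges.  Among graphs
    with a given number of edges, the one whose edges form an initial segment
    of the colexicographic order has the most [j]-cliques for all [j] at once
    (the graph case of the Kruskal-Katona theorem).  Its complement therefore
    maximises every coefficient of the independence polynomial simultaneously,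
    hence also the value at each [x >= 0].

    Write [M = 'C(a, 2) + b] with [b <= a].  The colex graph is a clique on [a]
    vertices, one more vertex joined to [b] of them, and isolated vertices; it
    has ['C(a, j) + 'C(b, j.-1)] cliques of size [j] for [j >= 2].  That this
    is an upper bound for any graph ([indep_num_le]) goes by induction on the
    number of vertices.  Delete a vertex [v] of least complement degree [d]:
    the cliques through [v] live in a neighbourhood of size [d], so there are at
    most ['C(d, j.-1)] of them, and the others are bounded by induction with
    [M - d] edges ([indep_numS]).  Minimality of [d] gives ['C(d.+1, 2) <= M]
    ([bin_min_nonadj]), hence [d <= b] or [d < a]; in both cases the two bounds
    add up to at most the desired one because [s |-> 'C(s, k)] is convex
    ([bin_convex]). *)

Set Implicit Arguments.
Unset Strict Implicit.
Unset Printing Implicit Defensive.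

Import Order.TTheory GRing.Theory Num.Theory.

(** * Binomial coefficients *)

(** The increment of [s |-> 'C(s, k.+1)] is ['C(s, k)], which is nondecreasing
    in [s]. *)
Lemma bin_convex s x y k :
  'C(s + x, k) + 'C(s + y, k) <= 'C(s + x + y, k) + 'C(s, k).
Proof.
elim: y => [|y IHy]; first by rewrite !addn0.
case: k IHy => [|k] IHy; first by rewrite !bin0.
rewrite !addnS !binS.
have : 'C(s + y, k) <= 'C(s + x + y, k) by apply: leq_bin2l; lia.
lia.
Qed.

(** The form [b <= a], rather than [b < a], costs uniqueness but allows [a < n]
    for all [M], including [M = 'C(n, 2)]. *)
Lemma bin2_decomp n M : 0 < n -> M <= 'C(n, 2) ->
  exists a b, [/\ a < n, b <= a & M = 'C(a, 2) + b].
Proof.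
case: n => // n _; elim: n => [|n IHn] leM.
  by exists 0, 0; split=> //; move: leM; rewrite !bin_small //; lia.
have [ltM|leCM] := ltnP M 'C(n.+1, 2).
  by have [a [b [? ? ?]]] := IHn (ltnW ltM); exists a, b; split=> //; lia.
by exists n.+1, (M - 'C(n.+1, 2)); move: leM; rewrite binS bin1; split=> //; lia.
Qed.

(** * Independent sets inside a vertex set *)

Section IndependentSets.

Variable G : sgraph.
Implicit Types (V W A : {set G}) (v : G).

Definition indep_sets V j : {set {set G}} :=
  [set A | [&& independent A, A \subset V & #|A| == j]].

Definition indep_num V j : nat := #|indep_sets V j|.

Definition nonadj v V : {set G} := [set u in V | (u != v) && ~~ adj v u].

Lemma independentP A :
  reflect {in A &, forall x y, ~~ adj x y} (independent A).
Proof.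
apply: (iffP forall_inP) => [indA x y Ax|indA x Ax].
  by move/forall_inP: (indA x Ax); apply.
by apply/forall_inP=> y; apply: indA.
Qed.

Lemma independentS A W : A \subset W -> independent W -> independent A.
Proof.
move=> /subsetP sAW /independentP indW; apply/independentP=> x y Ax Ay.
by apply: indW; apply: sAW.
Qed.

Lemma independentU1 v A :
  independent (v |: A) = independent A && [forall u in A, ~~ adj v u].
Proof.
apply/idP/andP=> [indvA|[/independentP indA /forall_inP nvA]].
  split; first exact: independentS (subsetU1 v A) indvA.
  apply/forall_inP=> u Au; move/independentP: indvA; apply.
    exact: setU11.
  exact: setU1r.
apply/independentP=> x y /setU1P[->|Ax] /setU1P[->|Ay].
- by rewrite adj_irr.
- exact: nvA.
- by rewrite adj_sym nvA.
- exact: indA.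
Qed.

Lemma indep_countE j : indep_count G j = indep_num [set: G] j.
Proof. by apply: eq_card => A; rewrite !inE subsetT. Qed.

Lemma indep_num_le_bin V j : indep_num V j <= 'C(#|V|, j).
Proof.
rewrite -cards_draws; apply/subset_leq_card/subsetP=> A.
by rewrite !inE => /andP[].
Qed.

Lemma indep_num_independent V j :
  independent V -> indep_num V j = 'C(#|V|, j).
Proof.
move=> indV; rewrite -cards_draws; apply: eq_card => A; rewrite !inE.
by case: (boolP (A \subset V)) => [/independentS->|]; rewrite ?andbF.
Qed.

Lemma indep_num0 V : indep_num V 0 = 1.
Proof.
rewrite -(cards1 (set0 : {set G})); apply: eq_card => A; rewrite !inE cards_eq0.
apply/and3P/eqP=> [[_ _ /eqP//]|->]; split=> //; last exact: sub0set.
by apply/independentP=> x y; rewrite inE.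
Qed.

Lemma indep_num1 V : indep_num V 1 = #|V|.
Proof.
rewrite -[RHS]bin1 -cards_draws; apply: eq_card => A; rewrite !inE.
case: (boolP (#|A| == 1)) => [/cards1P[x ->]|_]; rewrite ?andbF // !andbT.
rewrite andb_idl // => _; apply/independentP=> y z /set1P-> /set1P->.
by rewrite adj_irr.
Qed.

(** An independent set avoids [v], or is [v] together with an independent set
    of non-neighbours of [v].  At [k = 1] this is the recurrence for the number
    of complement edges. *)
Lemma indep_numS v V k : v \in V ->
  indep_num V k.+1 = indep_num (V :\ v) k.+1 + indep_num (nonadj v V) k.
Proof.
move=> Vv; rewrite /indep_num -(cardsID [set A : {set G} | v \in A]) addnC.
congr (_ + _).
  apply: eq_card => A; rewrite !inE subsetD1.
  by case: (v \in A); rewrite ?andbF ?andbT.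
have notin_nonadj (A : {set G}) : A \subset nonadj v V -> v \notin A.
  by move=> sA; apply/negP=> /(subsetP sA); rewrite !inE eqxx andbF.
have inj_add : {in indep_sets (nonadj v V) k &, injective (setU [set v])}.
  move=> A B; rewrite !inE => /and3P[_ sA _] /and3P[_ sB _] eqAB.
  by rewrite -(setU1K (notin_nonadj A sA)) eqAB setU1K ?notin_nonadj.
rewrite -(card_in_imset inj_add); apply: eq_card => A.
rewrite !inE; apply/andP/imsetP => [[/and3P[indA sAV cA] vA]|[B]].
  exists (A :\ v); last by rewrite setD1K.
  move: indA; rewrite -{1}(setD1K vA) independentU1.
  move=> /andP[indB /forall_inP nvB].
  move: cA; rewrite (cardsD1 v) vA eqSS inE indB => ->; rewrite andbT /=.
  apply/subsetP=> u uB; rewrite !inE nvB // andbT.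
  by move: uB; rewrite !inE => /andP[-> /(subsetP sAV)->].
rewrite inE => /and3P[indB sB /eqP cB] ->; split; last exact: setU11.
rewrite independentU1 indB cardsU1 notin_nonadj // cB add1n eqxx andbT /=.
apply/andP; split.
  by apply/forall_inP=> u /(subsetP sB); rewrite !inE => /and3P[].
rewrite subUset sub1set Vv; apply: subset_trans sB _.
by apply/subsetP=> u; rewrite !inE => /andP[].
Qed.

(** Deleting a vertex [v] lowers the other complement degrees by at most one
    and removes at least [d] complement edges, so induction on [d] gives
    [d + (d - 1) + ... + 1] of them. *)
Lemma bin_min_nonadj V d : V != set0 ->
  {in V, forall v, d <= #|nonadj v V|} -> 'C(d.+1, 2) <= indep_num V 2.
Proof.
elim: d V => [|d IHd] V /set0Pn[v Vv] degV; first by rewrite bin_small.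
rewrite (indep_numS _ Vv) indep_num1 binS bin1.
apply: leq_add; last exact: degV.
apply: IHd => [|u].
  have /card_gt0P[u] : 0 < #|nonadj v V| by apply: leq_trans (degV v Vv).
  by rewrite !inE => /and3P[Vu uv _]; apply/set0Pn; exists u; rewrite !inE uv.
rewrite !inE => /andP[_ Vu]; rewrite -ltnS.
apply: leq_trans (degV u Vu) _.
rewrite (cardsD1 v) -add1n; apply: leq_add; first exact: leq_b1.
apply/subset_leq_card/subsetP=> w; rewrite !inE.
by case/and4P=> -> -> -> ->.
Qed.

(** The Kruskal-Katona bound for cliques, stated in the complement.  Sizes 0
    and 1 are left out because there the count does not depend on the number
    of edges. *)
Lemma indep_num_le V a b k : b <= a -> indep_num V 2 = 'C(a, 2) + b ->
  indep_num V k.+2 <= 'C(a, k.+2) + 'C(b, k.+1).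
Proof.
elim: {V}#|V| {-2}V (erefl #|V|) a b => [|n IHn] V cV a b leba num2.
  by apply: leq_trans (indep_num_le_bin _ _) _; rewrite cV.
have /set0Pn[v0 Vv0] : V != set0 by rewrite -card_gt0 cV.
case: (@arg_minnP _ v0 (fun v => v \in V) (fun v => #|nonadj v V|) Vv0) => v Vv minv.
set d := #|nonadj v V| in minv.
have led : 'C(d.+1, 2) <= indep_num V 2.
  by apply: bin_min_nonadj => //; apply/set0Pn; exists v.
have cV' : #|V :\ v| = n by move: cV; rewrite (cardsD1 v) Vv => -[].
have leN : indep_num (nonadj v V) k.+1 <= 'C(d, k.+1) := indep_num_le_bin _ _.
have num2' : indep_num (V :\ v) 2 + d = 'C(a, 2) + b.
  by rewrite -num2 (indep_numS _ Vv) indep_num1.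
rewrite (indep_numS _ Vv).
have [ledb|ltbd] := leqP d b.
  have := bin_convex 0 (b - d) d k.+1; rewrite !add0n subnK // bin0n addn0.
  have := IHn _ cV' a (b - d) ltac:(lia) ltac:(lia); lia.
have ltda : d < a.
  rewrite ltnNge; apply/negP=> lead.
  by have := leq_bin2l 2 lead; move: led; rewrite binS bin1; lia.
case: a leba num2 num2' ltda => // a leba num2 num2' ltda.
(* Here [a.+1] stands for the former [a], and the new decomposition is
   ['C(a.+1, 2) + b - d = 'C(a, 2) + (a + b - d)]. *)
have IHa := IHn _ cV' a (a + b - d).
have := bin_convex b (a - d) (d - b) k.+1.
have -> : b + (a - d) = a + b - d by lia.
have -> : b + (d - b) = d by lia.
have -> : a + b - d + (d - b) = a by lia.
move: num2'; rewrite binS bin1 => num2' cvx; rewrite [in X in _ <= X]binS.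
have := IHa ltac:(lia) ltac:(lia); lia.
Qed.

(** A pair of vertices is either an edge or independent. *)
Lemma card_edges : #|edges G| + indep_num [set: G] 2 = 'C(#|G|, 2).
Proof.
rewrite -cardsT -cards_draws -[RHS](cardsID (indep_sets [set: G] 2)) addnC.
congr (_ + _).
  apply: eq_card => A; rewrite !inE subsetT /=.
  by case: (_ == 2); rewrite ?andbF ?andbT.
apply: eq_card => A; rewrite !inE subsetT /=.
apply/imset2P/andP => [[x y _]|[nindA /cards2P[x [y [neqxy defA]]]]].
  rewrite !inE => /= xy ->.
  have neqxy : x != y by apply: contraTneq xy => ->; rewrite adj_irr.
  rewrite cards2 neqxy; split=> //; rewrite andbT.
  apply/negP=> /independentP/(_ x y); rewrite !inE !eqxx orbT xy.
  by move=> /(_ isT isT).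
exists x y; rewrite ?inE //=.
apply: contraNT nindA => nxy; rewrite defA cards2 neqxy andbT independentU1.
apply/andP; split.
  by apply/independentP=> u w /set1P-> /set1P->; rewrite adj_irr.
by apply/forall_inP=> u /set1P->.
Qed.

End IndependentSets.

(** * The extremal graph *)

Section Colex.

Variables (n a b : nat).

(** The first ['C(a, 2) + b] pairs [i < j] in colexicographic order, that is,
    ordered by [j] and then by [i]. *)
Definition colex_pair (i j : nat) : bool :=
  (i < j) && ((j < a) || (j == a) && (i < b)).

Definition co_colex_adj (i j : 'I_n) : bool :=
  [&& i != j, ~~ colex_pair i j & ~~ colex_pair j i].

Lemma co_colex_adj_sym : symmetric co_colex_adj.
Proof. by move=> i j; rewrite /co_colex_adj eq_sym (andbC (~~ colex_pair _ _)). Qed.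

Lemma co_colex_adj_irr : irreflexive co_colex_adj.
Proof. by move=> i; rewrite /co_colex_adj eqxx. Qed.

Definition co_colex : sgraph := SGraph co_colex_adj_sym co_colex_adj_irr.

Lemma card_ord_lt c : c <= n -> #|[set i : co_colex | i < c]| = c.
Proof.
move=> lecn; rewrite -[RHS]card_ord.
have inj_widen : injective (widen_ord lecn).
  by move=> i j [eqij]; apply: val_inj.
rewrite -(card_imset predT inj_widen).
apply: eq_card => i; rewrite !inE; apply/idP/imsetP=> [ltic|[j _ ->]] //=.
by exists (Ordinal ltic) => //; apply: val_inj.
Qed.

Hypotheses (ltan : a < n) (leba : b <= a).

Lemma indep_num_co_colex k :
  indep_num [set: co_colex] k.+2 = 'C(a, k.+2) + 'C(b, k.+1).
Proof.
pose va : co_colex := Ordinal ltan.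
pose V : {set co_colex} := [set i : co_colex | i <= a].
have indep_lt c : c <= a -> independent [set i : co_colex | i < c].
  move=> leca; apply/independentP=> i j; rewrite !inE => ltic ltjc.
  rewrite /= /co_colex_adj /colex_pair -val_eqE /=; lia.
(* Vertices above [a] are adjacent to all others, so they lie in no independent
   set with two elements. *)
have -> : indep_num [set: co_colex] k.+2 = indep_num V k.+2.
  apply: eq_card => A; rewrite !inE subsetT /=.
  case: (boolP (independent A)) => //= /independentP indA.
  case: (boolP (#|A| == _)) => [/eqP cA|]; rewrite ?andbF // andbT.
  apply/esym/subsetP=> i Ai; rewrite inE.
  have /card_gt0P[j] : 0 < #|A :\ i|.
    by move: cA; rewrite (cardsD1 i) Ai add1n => -[->].
  rewrite !inE => /andP[neqji Aj]; move: (indA _ _ Ai Aj) neqji.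
  rewrite /= /co_colex_adj /colex_pair -!val_eqE /=; lia.
have Va : va \in V by rewrite inE /=.
rewrite (indep_numS _ Va); congr (_ + _).
  have -> : V :\ va = [set i : co_colex | i < a].
    by apply/setP=> i; rewrite !inE -val_eqE /= ltn_neqAle.
  by rewrite indep_num_independent ?indep_lt // card_ord_lt // ltnW.
have -> : nonadj va V = [set i : co_colex | i < b].
  apply/setP=> i; rewrite !inE /= /co_colex_adj /colex_pair -!val_eqE /=; lia.
by rewrite indep_num_independent ?indep_lt // card_ord_lt //; lia.
Qed.

End Colex.

Theorem theorem1 (R : realType) (n m : nat) (hn : (1 <= n)%N)
  (hm : (m <= 'C(n, 2))%N) :
  exists H : sgraph, optimally_greatest R n m H.
Proof.
have [a [b [ltan leba defM]]] := bin2_decomp hn (leq_subr m 'C(n, 2)).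
pose H := co_colex n a b; have cH : #|H| = n by rewrite card_ord.
have numH k := indep_num_co_colex ltan leba k.
exists H; split.
  split=> //; have := card_edges H; rewrite cH numH bin1 -defM; lia.
move=> G [cG eG] x x_ge0; rewrite /indep_poly !horner_poly cG cH.
apply: ler_sum => j _; apply: ler_wpM2r; first exact: exprn_ge0.
rewrite ler_nat !indep_countE.
case: (nat_of_ord j) => [|[|k]]; first by rewrite !indep_num0.
  by rewrite !indep_num1 !cardsT cG cH.
rewrite numH; apply: indep_num_le => //.
by have := card_edges G; rewrite cG eG -defM => <-; rewrite addKn.
Qed.
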